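(* Let $n\geq3$ and $k\geq3$, and let $\lambda(N,k)$ denote the maximum period of a $k$-ary orientable sequence of order $N$. Then, with $s_k(n-1)$ as defined in the context, \[ \frac{k\,s_k(n-1)}{\lambda(n+1,k)}\rightarrow 1 \text{ as } n\rightarrow\infty\ (k\text{ fixed}),\qquad \frac{k\,s_k(n-1)}{\lambda(n+1,k)}\rightarrow 1 \text{ as } k\rightarrow\infty\ (n\text{ fixed}). \]
   Context: A $k$-ary sequence is a periodic sequence $S=(s_i)$ with entries in $\mathbb{Z}_k$; its period is the least positive $p$ with $s_{i+p}=s_i$ for all $i$. Write $\mathbf{s}_N(i)=(s_i,\dots,s_{i+N-1})$. $S$ is an $N$-window sequence if $\mathbf{s}_N(i)=\mathbf{s}_N(j)$ implies $i\equiv j\pmod p$. An orientable sequence of order $N$ is a $k$-ary $N$-window sequence with $\mathbf{s}_N(i)\neq\mathbf{s}_N(j)^R$ for all $i,j$, where $\mathbf{u}^R$ is the reverse of $\mathbf{u}$. Let $\delta=1$ if $k$ is odd and $\delta=2$ if $k$ is even, and write $n=2^tm$ with $m$ odd. Define $s_k(n-1)=\frac{k^n-\delta(n(k^{(n-1)/2}-1)+1)}{2}$ if $n$ is odd, and $s_k(n-1)=\frac{k^n - \frac{nk^{(n-2)/2}}{2}(\delta^2+k) +n\delta k^{(m-1)/2} - m\delta(k^{(m-1)/2}-1)-\delta}{2}$ if $n$ is even. *)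

(* Defs.v *)
From HB Require Import structures.
From mathcomp Require Import all_boot all_order all_algebra.
From mathcomp Require Import all_classical all_reals all_analysis.

Set Implicit Arguments.
Unset Strict Implicit.
Unset Printing Implicit Defensive.

Import Order.TTheory GRing.Theory Num.Theory.
Import numFieldNormedType.Exports.

Local Open Scope classical_set_scope.
Local Open Scope ring_scope.

(* A k-ary sequence is a purely periodic S : nat -> 'Z_k; 'Z_k has k elements
   only for 1 < k. *)
Definition is_period (k : nat) (S : nat -> 'Z_k) (p : nat) : Prop :=
  [/\ (0 < p)%N,
      forall i, S (i + p)%N = S i &
      forall q, (0 < q)%N -> (forall i, S (i + q)%N = S i) -> (p <= q)%N].

Definition window (k : nat) (S : nat -> 'Z_k) (N i : nat) : seq 'Z_k :=
  mkseq (fun j => S (i + j)%N) N.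

Definition window_sequence (k N : nat) (S : nat -> 'Z_k) (p : nat) : Prop :=
  is_period S p /\
  forall i j, window S N i = window S N j -> (i = j %[mod p])%N.

Definition orientable_sequence (k N : nat) (S : nat -> 'Z_k) (p : nat) : Prop :=
  window_sequence N S p /\
  forall i j, window S N i <> rev (window S N j).

Definition is_max_period (N k L : nat) : Prop :=
  (exists S : nat -> 'Z_k, orientable_sequence N S L) /\
  (forall (S : nat -> 'Z_k) (p : nat), orientable_sequence N S p -> (p <= L)%N).

(* The default value 0 is not used when 1 < N and 2 < k: see lambdaP. *)
Definition lambda (N k : nat) : nat := xget 0%N [set L | is_max_period N k L].

Definition delta (k : nat) : nat := if odd k then 1%N else 2%N.

Definition odd_part (n : nat) : nat := (n %/ 2 ^ logn 2 n)%N.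

(* The formula for s_k(n-1) is given in terms of n; here N = n - 1. All the
   halved exponents are exact in the branch where they occur. *)
Definition sk (R : realType) (k N : nat) : R :=
  let n := N.+1 in
  let m := odd_part n in
  let K : R := k%:R in
  let d : R := (delta k)%:R in
  if odd n then
    (K ^+ n - d * (n%:R * (K ^+ ((n - 1) %/ 2) - 1) + 1)) / 2
  else
    (K ^+ n - n%:R * K ^+ ((n - 2) %/ 2) / 2 * (d ^+ 2 + K)
       + n%:R * d * K ^+ ((m - 1) %/ 2)
       - m%:R * d * (K ^+ ((m - 1) %/ 2) - 1) - d) / 2.

Lemma window_sequence_period_le (k N : nat) (S : nat -> 'Z_k) (p : nat) :
  window_sequence N S p -> (p <= #|'Z_k| ^ N)%N.
Proof.
move=> [[p0 _ _] w].
pose f (i : 'I_p) := [tuple S (i + j)%N | j < N].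
have finj : injective f.
  move=> i j fij; apply: val_inj.
  rewrite -[LHS](modn_small (ltn_ord i)) -[RHS](modn_small (ltn_ord j)).
  apply: w; apply: (@eq_from_nth _ 0); rewrite !size_mkseq // => l lN.
  rewrite !nth_mkseq //.
  by have := congr1 (fun t => tnth t (Ordinal lN)) fij; rewrite !tnth_mktuple.
by have := leq_card f finj; rewrite card_tuple [X in (X <= _)%N -> _]card_ord.
Qed.

Lemma orientable_sequence_exists (k N : nat) : (1 < N)%N -> (2 < k)%N ->
  exists (S : nat -> 'Z_k) (p : nat), orientable_sequence N S p.
Proof.
case: N => [|[|N]] // _; case: k => [|[|[|k]]] // _.
pose S (i : nat) : 'Z_k.+3 := inZp (i %% 3)%N.
have small i : (i %% 3 < k.+3)%N by apply: leq_trans (ltn_pmod i _) _.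
have SE i j : S i = S j -> (i %% 3 = j %% 3)%N.
  by move=> /(congr1 val) /=; rewrite !(modn_small (small _)).
exists S, 3%N; split.
- split; first split=> //.
  + by move=> i; rewrite /S modnDr.
  + move=> [|[|[|q]]] // _ /(_ 0%N) /SE //.
  + move=> i j /(congr1 (fun t => nth 0 t 0%N)).
    by rewrite !nth_mkseq // !addn0 => /SE.
- move=> i j e.
  have n0 := congr1 (fun t => nth 0 t 0%N) e.
  have n1 := congr1 (fun t => nth 0 t 1%N) e.
  move: n0 n1; rewrite !nth_rev ?size_mkseq // !nth_mkseq ?ltn_subrL //.
  rewrite !subSS !subn0 addn0 addn1 addnS => /SE e0 /SE e1.
  have : ((j + N).+1.+1 = j + N %[mod 3])%N.
    by rewrite -e1 -[in RHS]addn1 -[in LHS]addn1 -modnDml -e0 modnDml.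
  by move/eqP; rewrite -addn2 -[X in _ == X %[mod _]](addn0 (j + N)) eqn_modDl.
Qed.

Lemma lambdaP (N k : nat) : (1 < N)%N -> (2 < k)%N ->
  is_max_period N k (lambda N k).
Proof.
move=> N1 k2; rewrite /lambda.
case: xgetP => [L _ //|none].
pose P p := `[< exists S : nat -> 'Z_k, orientable_sequence N S p >].
have exP : exists p, P p.
  have [S [p Sp]] := orientable_sequence_exists N1 k2.
  by exists p; apply/asboolP; exists S.
have bP p : P p -> (p <= #|'Z_k| ^ N)%N.
  by move=> /asboolP[S [/window_sequence_period_le]].
case: (ex_maxnP exP bP) => L /asboolP LP Lmax; case: (none L).
by split=> // S p Sp; apply/Lmax/asboolP; exists S.
Qed.

(* Main.v *)
Require Import Defs.
From HB Require Import structures.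
From mathcomp Require Import all_boot all_order all_algebra.
From mathcomp Require Import fingroup perm zify ring lra.
From mathcomp Require Import all_classical all_reals all_analysis.

(** Both [k * s_k(n-1)] and [lambda (n+1) k] are asymptotic to [k^(n+1) / 2].

    Reversal gives [2 * lambda (n+1) k <= k^(n+1)]. For the lower bound, weigh
    a difference [a] by [g 0 = k] and [g a = 2k - 2a] otherwise, so that
    [g a + g (-a) = 2k], and keep the words of length [n+1] whose [n] successive
    differences have total weight [> nk]. Reversing a word negates its
    differences, hence takes a kept word to a word that is not kept. As edges of
    the de Bruijn graph the kept words form a balanced subgraph (rotate the
    differences), connected since appending the difference 1, which has maximal
    weight, leads from any kept word to the word with differences [1, ..., 1].
    An Eulerian circuit is therefore an orientable sequence, and it misses
    [k^(n+1) / 2] by at most half the number of words of weight exactly [nk].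

    The latter number is [k] times a coefficient of [(sum_a X^(g a))^n]. It is
    at most [2 k^n] because [g] is at most two-to-one; and for fixed [k], it is
    [o(k^(n+1))]: split off [X^(g 1) + X^(g 0)] from the sum, and use that
    ['C(j, i) / 2^j] tends to 0 uniformly in [i]. *)

Set Implicit Arguments.
Unset Strict Implicit.
Unset Printing Implicit Defensive.

Import Order.TTheory GRing.Theory Num.Theory.
Import numFieldNormedType.Exports.

Local Open Scope classical_set_scope.
Local Open Scope ring_scope.

(** * Eulerian circuits *)

(* Take a successor permutation with the fewest cycles: two edges with the same
   target lie on one cycle, since a transposition would merge their cycles. *)
Lemma eulerian_perm (T : finType) (V : eqType) (src tgt : T -> V)
    (s0 : {perm T}) (e0 : T) :
  (forall e, src (s0 e) = tgt e) ->
  (forall e, connect [rel x y | src y == tgt x] e e0) ->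
  exists s : {perm T}, (forall e, src (s e) = tgt e) /\
    (forall e, e \in porbit s e0).
Proof.
move=> s0P con.
pose ok := [pred s : {perm T} | [forall e, src (s e) == tgt e]].
have ok0 : ok s0 by apply/forallP => e; rewrite s0P.
pose s := [arg min_(s < s0 | ok s) #|porbits s|].
have [oks mins] : ok s /\ forall s', ok s' -> (#|porbits s| <= #|porbits s'|)%N.
  by rewrite /s; case: arg_minnP.
have {}oks e : src (s e) = tgt e by apply/eqP/(forallP oks).
exists s; split=> // e.
have same_tgt x y : tgt x = tgt y -> x \in porbit s y.
  move=> xy; apply: contraT => nxy.
  have okt : ok (tperm x y * s)%g.
    apply/forallP => z; rewrite permM oks.
    by case: tpermP => [->|->|//]; rewrite ?xy.
  have neq : x != y by apply: contraNneq nxy => ->; rewrite porbit_id.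
  have := porbits_mul_tperm s x y; have := mins _ okt.
  by rewrite /= nxy neq; lia.
have step x y : src y = tgt x -> y \in porbit s x.
  move=> xy; have: (s^-1)%g y \in porbit s x.
    by apply: same_tgt; rewrite -oks permKV.
  rewrite -eq_porbit_mem => /eqP <-.
  by have := mem_porbit s 1 ((s^-1)%g y); rewrite expg1 permKV.
have /connectP[p pP ->] := con e.
elim: p e pP => [|y p IH] x /=; first by rewrite porbit_id.
case/andP=> /eqP xy /IH yl.
rewrite porbit_sym; rewrite porbit_sym in yl.
have := step _ _ xy; rewrite -!eq_porbit_mem in yl *.
by rewrite (eqP yl) => /eqP ->.
Qed.

(** Iterates depend only on the exponent modulo the cycle length, and those below that length are
    distinct. This yields both the window property and the minimality of the period. *)
Lemma iter_porbit_eqmod (T : finType) (s : {perm T}) (x : T) (i j : nat) :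
  iter i s x = iter j s x -> (i = j %[mod #|porbit s x|])%N.
Proof.
set c := #|porbit s x|; have c0 : (0 < c)%N by rewrite lt0n card_porbit_neq0.
have per l : iter l s x = iter (l %% c)%N s x.
  rewrite {1}(divn_eq l c) addnC iterD; congr iter.
  by elim: (l %/ c)%N => [//|q IH]; rewrite mulSn iterD IH iter_porbit.
rewrite per [RHS]per => ij; apply/eqP.
rewrite -(nth_uniq x _ _ (uniq_traject_porbit s x)) ?size_traject ?ltn_pmod //.
by rewrite !nth_traject ?ltn_pmod // ij.
Qed.

(** * Difference weights and the graph of heavy words *)

Definition diff_wt (k : nat) (a : 'Z_k) : nat :=
  if a == 0 then k else (2 * k - 2 * a)%N.

Definition seq_wt (k : nat) (d : seq 'Z_k) : nat := (\sum_(a <- d) diff_wt a)%N.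

Lemma diff_wtN (k : nat) (a : 'Z_k) : (1 < k)%N ->
  (diff_wt a + diff_wt (- a) = 2 * k)%N.
Proof.
case: k a => [|[|k]] // a _; rewrite /diff_wt oppr_eq0.
case: eqVneq => [_|a0]; first by lia.
have {a0} : (0 < nat_of_ord a)%N by rewrite lt0n.
have := ltn_ord a; rewrite /= /Zp_trunc /= => ak a0.
by rewrite modn_small; lia.
Qed.

Lemma diff_wt1 (k : nat) : (2 < k)%N -> diff_wt (1%R : 'Z_k) = (2 * k - 2)%N.
Proof. by case: k => [|[|[|k]]]. Qed.

Lemma diff_wt_le1 (k : nat) (a : 'Z_k) : (2 < k)%N ->
  (diff_wt a <= diff_wt (1%R : 'Z_k))%N.
Proof.
move=> k2; rewrite diff_wt1 // /diff_wt; case: eqVneq => [_|a0]; first by lia.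
have : (0 < nat_of_ord a)%N by rewrite lt0n.
by lia.
Qed.

Lemma seq_wt_cat (k : nat) (d e : seq 'Z_k) :
  seq_wt (d ++ e) = (seq_wt d + seq_wt e)%N.
Proof. exact: big_cat. Qed.

Lemma seq_wt_cons (k : nat) (a : 'Z_k) (d : seq 'Z_k) :
  seq_wt (a :: d) = (diff_wt a + seq_wt d)%N.
Proof. exact: big_cons. Qed.

Lemma seq_wt_rot (k i : nat) (d : seq 'Z_k) : seq_wt (rot i d) = seq_wt d.
Proof. by rewrite /rot seq_wt_cat addnC -seq_wt_cat cat_take_drop. Qed.

Definition heavy (k n : nat) (e : 'Z_k * n.-tuple 'Z_k) : bool :=
  (n * k < seq_wt e.2)%N.

(* An edge [(a, d)] stands for the word starting at [a] with successive
   differences [d]; it joins its prefix to its suffix. *)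
Definition edge_src (k n : nat) (e : {e : 'Z_k * n.-tuple 'Z_k | heavy e}) :=
  ((val e).1, take n.-1 (val e).2).

Definition edge_tgt (k n : nat) (e : {e : 'Z_k * n.-tuple 'Z_k | heavy e}) :=
  ((val e).1 + head 0 (val e).2, behead (val e).2).

Lemma heavy_euler (k n : nat) : (0 < n)%N -> (2 < k)%N ->
  exists (s : {perm {e : 'Z_k * n.-tuple 'Z_k | heavy e}})
    (e0 : {e : 'Z_k * n.-tuple 'Z_k | heavy e}),
  (forall e, edge_src (s e) = edge_tgt e) /\ (forall e, e \in porbit s e0).
Proof.
case: n => [//|n] _ k2.
pose T := {e : 'Z_k * n.+1.-tuple 'Z_k | heavy e}.
(* Rotating the differences keeps the weight and gives an edge whose source is the target of [e];
   being injective, this is the initial successor permutation. *)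
have rotP (e : T) :
    heavy ((val e).1 + head 0 (val e).2, [tuple of rot 1 (val e).2]).
  by rewrite /heavy /= seq_wt_rot; apply: (valP e).
pose rotf (e : T) : T := Sub _ (rotP e).
have rot_inj : injective rotf.
  move=> [[a d] P] [[b c] Q] /(congr1 val) /= eqr; apply: val_inj => /=.
  have cd : d = c by apply/val_inj/(@rot_inj 1)/(congr1 (fun e => tval e.2) eqr).
  have := congr1 fst eqr; rewrite /= cd => /addIr ->; congr (_, _).
have pushP (e : T) : heavy ((val e).1 + head 0 (val e).2,
    [tuple of rcons (behead (val e).2) 1]).
  case: e => -[a d] P /=; apply: leq_trans P _; case/tupleP: d => x d /=.
  rewrite -cats1 seq_wt_cat !seq_wt_cons [seq_wt [::]]big_nil addn0.
  by rewrite addnC leq_add2l diff_wt_le1.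
pose push (e : T) : T := Sub _ (pushP e).
have oneP : heavy ((0 : 'Z_k), [tuple of nseq n.+1 (1 : 'Z_k)]).
  change (n.+1 * k < seq_wt (nseq n.+1 (1%R : 'Z_k)))%N.
  by rewrite /seq_wt big_nseq iter_addn_0 diff_wt1 //; nia.
have rcons1 m : rcons (nseq m (1 : 'Z_k)) 1 = nseq m.+1 1 by elim: m => //= m ->.
(* The first [n.+1] pushes turn every difference into 1. From then on a push adds 1 to the starting
   letter, so as many further pushes as the value of its opposite bring it to 0. *)
have e0P (e : T) : exists m, iter m push e = Sub _ oneP.
  have it m (x : T) : (m <= n.+1)%N ->
      tval (val (iter m push x)).2 = drop m (val x).2 ++ nseq m 1.
    elim: m => [|m IH] mn; first by rewrite drop0 cats0.
    rewrite iterS /= (IH (ltnW mn)).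
    have : (m < size (val x).2)%N by rewrite size_tuple.
    case: (drop m _) (size_drop m (val x).2) (drop_drop (val x).2 1 m)
      => /= [|y d] sz.
      by move=> _; lia.
    by rewrite drop0 add1n => <- _; rewrite rcons_cat rcons1.
  have add m (x : T) : tval (val x).2 = nseq n.+1 1 ->
      tval (val (iter m push x)).2 = nseq n.+1 1 /\
      (val (iter m push x)).1 = (val x).1 + m%:R.
    move=> hx; elim: m => [|m [IH1 IH2]]; first by rewrite addr0.
    split; rewrite iterS /= IH1 /=; first by rewrite rcons1.
    by rewrite IH2 -addrA -natr1.
  pose f := iter n.+1 push e.
  have hf : tval (val f).2 = nseq n.+1 1 by rewrite it // drop_oversize ?size_tuple.
  have [h1 h2] := add (val (- (val f).1))%N f hf.
  exists ((val (- (val f).1))%N + n.+1)%N; rewrite iterD -/f.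
  apply: val_inj => /=; rewrite [LHS]surjective_pairing.
  congr (_, _); last exact: val_inj.
  by rewrite h2 natr_Zp subrr.
have srcrot e : edge_src (perm rot_inj e) = edge_tgt e.
  rewrite permE /edge_src /edge_tgt /=; congr (_, _).
  case: e => -[a d] P /=; case/tupleP: {P} d => x d /=.
  by rewrite rot1_cons -cats1 take_size_cat ?size_tuple.
have con e : connect [rel x y | edge_src y == edge_tgt x] e (Sub _ oneP : T).
  have [m <-] := e0P e; elim: m e => [|m IH] e; first exact: connect0.
  rewrite iterSr; apply: connect_trans (IH _); apply: connect1 => /=; apply/eqP.
  rewrite /edge_src /edge_tgt /=; congr (_, _).
  case: e => -[a d] P /=; case/tupleP: {P} d => x d /=.
  by rewrite -cats1 take_size_cat ?size_tuple.
by have [s sP] := eulerian_perm srcrot con; exists s, (Sub _ oneP).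
Qed.

Lemma window_nth (k N : nat) (S : nat -> 'Z_k) (i l : nat) : (l < N)%N ->
  nth 0 (window S N i) l = S (i + l)%N.
Proof. by move=> lN; rewrite nth_mkseq. Qed.

(** [S] lists the starting letters along the Eulerian circuit. A window of length [n.+1] determines
    its edge, so windows repeat only when the circuit does, and the period is the number of
    edges. *)
Lemma heavy_orientable (k n : nat) : (0 < n)%N -> (2 < k)%N ->
  exists S : nat -> 'Z_k,
    orientable_sequence n.+1 S #|{: {e : 'Z_k * n.-tuple 'Z_k | heavy e}}|.
Proof.
move=> n0 k2; have [s [e0 [sP s1]]] := heavy_euler n0 k2.
pose st i := iter i s e0; pose S i := (val (st i)).1.
have cardT : #|porbit s e0| = #|{: {e : 'Z_k * n.-tuple 'Z_k | heavy e}}|.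
  by apply: eq_card => e; rewrite s1.
have S1 i : S i.+1 = S i + head 0 (val (st i)).2 by have [] := sP (st i).
have d1 i : behead (val (st i)).2 = take n.-1 (val (st i.+1)).2.
  by have [] := sP (st i).
have dE l i : (l < n)%N -> nth 0 (val (st i)).2 l = S (i + l).+1 - S (i + l)%N.
  elim: l i => [|l IH] i ln; first by rewrite addn0 S1 addrC addKr nth0.
  by rewrite -nth_behead d1 nth_take ?IH ?addnS //; lia.
have wE i j : window S n.+1 i = window S n.+1 j -> st i = st j.
  move=> ij; have {}ij l : (l < n.+1)%N -> S (i + l)%N = S (j + l)%N.
    by move=> ln; rewrite -!(window_nth _ _ ln) ij.
  apply: val_inj; rewrite [LHS]surjective_pairing [RHS]surjective_pairing.
  congr (_, _); first by have := ij 0%N isT; rewrite !addn0.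
  apply/val_inj/(@eq_from_nth _ 0); rewrite !size_tuple // => l ln.
  by rewrite !dE // -!addnS !ij //; lia.
have wt i : (n * k < \sum_(l < n) diff_wt (S (i + l).+1 - S (i + l)%N)%R)%N.
  have := valP (st i); rewrite /heavy /seq_wt (big_nth 0) big_mkord size_tuple.
  by under eq_bigr => l _ do rewrite dE //.
exists S; rewrite -cardT; split; [split; [split|]|].
- by rewrite lt0n card_porbit_neq0.
- by move=> i; rewrite /S /st iterD iter_porbit.
- move=> q q0 Sq.
  have := @iter_porbit_eqmod _ s e0 q 0; rewrite mod0n => H; apply: dvdn_leq => //.
  apply/eqP/H/(wE q 0%N)/eq_mkseq => l.
  by rewrite addnC Sq.
- by move=> i j /wE /iter_porbit_eqmod.
- move=> i j ij; have {}ij l : (l < n.+1)%N -> S (i + l)%N = S (j + (n - l))%N.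
    move=> ln; rewrite -(window_nth _ _ ln) ij nth_rev ?size_mkseq //.
    by rewrite window_nth ?subSS //; lia.
  (* If the window at [i] reverses the one at [j], their differences are opposite in reverse order,
     so the two weights add up to [2nk], although each exceeds [nk]. *)
  have := wt i; have := wt j; rewrite (reindex_inj rev_ord_inj) /=.
  have : (\sum_(l < n) diff_wt (S (i + l).+1 - S (i + l)%N)%R
        + \sum_(l < n) diff_wt (S (j + (n - l.+1)).+1 - S (j + (n - l.+1))%N)%R
        = n * (2 * k))%N.
    rewrite -big_split /= -[n in RHS]card_ord -sum_nat_const.
    apply: eq_bigr => l _; have ln := ltn_ord l; rewrite -addnS !ij; [|lia|lia].
    by rewrite -addnS subnSK // -opprB addnC diff_wtN //; lia.
  set A := bigop _ _ _; set B := bigop _ _ _; nia.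
Qed.

(** * Counting words by weight *)

Definition ties (k n : nat) : nat :=
  #|[pred d : n.-tuple 'Z_k | seq_wt d == (n * k)%N]|.

Lemma card_Zk (k : nat) : (1 < k)%N -> #|'Z_k| = k.
Proof. by move=> k1; rewrite card_ord Zp_cast. Qed.

Lemma seq_wtN (k : nat) (d : seq 'Z_k) : (1 < k)%N ->
  (seq_wt d + seq_wt (map -%R d) = size d * (2 * k))%N.
Proof.
move=> k1; elim: d => [|a d IH]; first by rewrite /seq_wt !big_nil.
by rewrite /= !seq_wt_cons mulSn -IH -(diff_wtN a k1) addnACA.
Qed.

(** Negating all differences exchanges weights above and below [n * k]; what remains are the ties.
    The factor [k] counts starting letters. *)
Lemma card_heavy (k n : nat) : (1 < k)%N ->
  (2 * #|{: {e : 'Z_k * n.-tuple 'Z_k | heavy e}}| + k * ties k n = k ^ n.+1)%N.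
Proof.
move=> k1; rewrite card_sig.
pose H := [pred d : n.-tuple 'Z_k | n * k < seq_wt d]%N.
have -> : #|[pred e : 'Z_k * n.-tuple 'Z_k | heavy e]| = (k * #|H|)%N.
  transitivity (#|'Z_k| * #|H|)%N; last by rewrite card_Zk.
  rewrite -cardX; apply: eq_card => -[a d].
  by rewrite !inE.
pose L := [pred d : n.-tuple 'Z_k | seq_wt d < n * k]%N.
have HL : #|H| = #|L|.
  pose opp (d : n.-tuple 'Z_k) : n.-tuple 'Z_k := [tuple of map -%R d].
  have oppK : involutive opp.
    move=> d; apply: val_inj; rewrite /= -map_comp map_id_in // => a _.
    exact: opprK.
  rewrite -(fintype.card_image (inv_inj oppK) L); apply: eq_card => d.
  rewrite -[d in RHS]oppK fintype.mem_image ?inE; last exact: inv_inj.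
  by have := seq_wtN d k1; rewrite size_tuple /=; lia.
have : (#|H| + ties k n + #|L| = k ^ n)%N.
  have -> : (k ^ n)%N = #|{: n.-tuple 'Z_k}| by rewrite card_tuple card_Zk.
  rewrite -(cardC L) -[RHS]addnC; congr (_ + _)%N.
  rewrite /ties -cardUI [X in (_ + X)%N]eq_card0 ?addn0; last first.
    by move=> d; rewrite !inE; case: ltngtP.
  by apply: eq_card => d; rewrite !inE; case: ltngtP.
by rewrite -HL expnS => <-; lia.
Qed.

Definition wt_poly (k : nat) : {poly nat} := \sum_(a : 'Z_k) 'X^(diff_wt a).

Lemma ties_coef (k n : nat) : ties k n = (wt_poly k ^+ n)`_(n * k).
Proof.
have -> : wt_poly k ^+ n = \sum_(d : n.-tuple 'Z_k) 'X^(seq_wt d).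
  rewrite -[n in LHS]card_ord -prodr_const bigA_distr_bigA /=.
  rewrite (reindex (fun d : n.-tuple 'Z_k => [ffun i => tnth d i])) /=; last first.
    exists (fun f : {ffun 'I_n -> 'Z_k} => [tuple f i | i < n]) => [d|f] _.
      by apply: eq_from_tnth => i; rewrite tnth_mktuple ffunE.
    by apply/ffunP => i; rewrite ffunE tnth_mktuple.
  apply: eq_bigr => d _; rewrite /seq_wt big_tuple expr_sum.
  by apply: eq_bigr => i _; rewrite ffunE.
rewrite coef_sum /ties -sum1_card [LHS]big_mkcond /=.
by apply: eq_bigr => d _; rewrite coefXn inE eq_sym; case: eqP.
Qed.

(** * Bounds on binomial and polynomial coefficients *)

Lemma central_bin_le (m : nat) : ('C(m.*2, m) ^ 2 * m.*2.+1 <= 16 ^ m)%N.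
Proof.
elim: m => [//|m IH]; rewrite doubleS.
set a := 'C(m.*2, m) in IH; set b := 'C(_, _).
have ab : (m.+1 * b = 2 * (m.*2.+1 * a))%N.
  have := mul_bin_diag m.*2.+2 m; have := mul_bin_down m.*2.+1 m.
  rewrite /= -/a -/b => -> <-.
  have -> : (m.*2.+1 - m = m.+1)%N by lia.
  by move: 'C(_, _) => c; lia.
rewrite -(@leq_pmul2l (m.+1 ^ 2)%N) ?expn_gt0 // mulnA -expnMn ab
  [(16 ^ m.+1)%N]expnS.
have -> : ((2 * (m.*2.+1 * a)) ^ 2 * m.*2.+3 =
    4 * m.*2.+1 * m.*2.+3 * (a ^ 2 * m.*2.+1))%N.
  by rewrite !expnMn; move: (a ^ 2)%N => x; lia.
(* What remains is [4 (2m+1) (2m+3) <= 16 (m+1)^2]. *)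
apply: leq_trans (leq_mul (leqnn _) IH) _.
rewrite mulnA leq_mul2r; apply/orP; right.
by rewrite -!mul2n; lia.
Qed.

(* The fourth power comes from ['C(j, i) ^ 2 <= \sum_l 'C(j, l) ^ 2 = 'C(2j, j)]. *)
Lemma bin_pow4_le (j i : nat) : ('C(j, i) ^ 4 * j.*2.+1 <= 16 ^ j)%N.
Proof.
have [ij|ij] := leqP i j; last by rewrite bin_small.
apply: leq_trans (central_bin_le j); rewrite leq_mul2r /= (expnM _ 2 2).
rewrite leq_exp2r // -[j.*2]addnn -binomial.Vandermonde.
rewrite (bigD1 (Ordinal (ij : (i < j.+1)%N))) //= bin_sub // mulnn.
exact: leq_addr.
Qed.

Lemma sum_coef_le (Q : {poly nat}) (m : nat) : ((\sum_(j < m) Q`_j)%R <= Q.[1]%R)%N.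
Proof.
rewrite (@horner_coef_wide _ (maxn m (size Q))) ?leq_maxr //.
rewrite (big_ord_widen _ (fun j => Q`_j) (leq_maxl m (size Q))) big_mkcond /=.
apply: leq_sum => j _; rewrite expr1n mulr1.
by case: ifP.
Qed.

(** In the convolution, the largest coefficient of [P] up to degree [i] is factored out; the
    coefficients of [Q] sum to [Q.[1]]. *)
Lemma coefM_le (P Q : {poly nat}) (i : nat) :
  exists l, (((P * Q)`_i)%R <= (P`_l)%R * Q.[1]%R)%N.
Proof.
pose l := [arg max_(l > (ord0 : 'I_i.+1)) (P`_l)%R]%N.
exists l; rewrite coefMr.
apply: leq_trans (_ : (\sum_(j < i.+1) P`_l * Q`_j)%R <= _)%N.
  apply: leq_sum => j _; apply: leq_mul => //.
  rewrite /l; case: arg_maxnP => // o _ /(_ (inord (i - j))) /=.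
  by rewrite inordK ?ltnS ?leq_subr //; apply.
by rewrite -big_distrr /= leq_mul2l sum_coef_le orbT.
Qed.

(** As [u] and [v] differ, at most one term of the binomial expansion has degree [i], so the
    coefficient is 0 or a binomial coefficient. *)
Lemma two_term_pow_coef (u v j i : nat) : (v < u)%N ->
  (((('X^u + 'X^v : {poly nat}) ^+ j)`_i)%R ^ 4 * j.*2.+1 <= 16 ^ j)%N.
Proof.
move=> vu; rewrite exprDn coef_sum.
have E (l : 'I_j.+1) : ('X^u ^+ (j - l) * 'X^v ^+ l *+ 'C(j, l) : {poly nat})`_i =
    if (u * (j - l) + v * l == i)%N then 'C(j, l) else 0%N.
  rewrite coefMn -!exprM -exprD coefXn eq_sym.
  case: ifP => _; last by rewrite mul0rn.
  by rewrite natn.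
rewrite (eq_bigr _ (fun l _ => E l)).
have [/existsP[l /eqP li]|/existsPn none] :=
    boolP [exists l : 'I_j.+1, (u * (j - l) + v * l == i)%N].
  rewrite (bigD1 l) //= big1 => [|l' nl].
    by rewrite li eqxx addr0 bin_pow4_le.
  case: eqP => // l'i; case/eqP: nl; apply: val_inj => /=.
  have := ltn_ord l; have := ltn_ord l'; nia.
by rewrite big1 // => l _; rewrite (negbTE (none l)).
Qed.

Lemma wt_poly1 (k : nat) : (1 < k)%N -> (wt_poly k).[1] = k.
Proof.
move=> k1; rewrite horner_sum (eq_bigr (fun=> 1%R)) => [|a _].
  by rewrite sumr_const card_Zk ?natn.
by rewrite hornerXn expr1n.
Qed.

Lemma ties_le2 (k n : nat) : (2 < k)%N -> (ties k n.+1 <= 2 * k ^ n)%N.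
Proof.
move=> k2; rewrite ties_coef exprS; set P := wt_poly k.
have [l] := coefM_le P (P ^+ n) (n.+1 * k).
rewrite horner_exp wt_poly1 ?(ltnW k2) // => h.
apply: leq_trans h _; rewrite leq_mul //.
(* A coefficient of [P] is at most 2: one from the difference 0, and one from the nonzero
   differences, whose weights are distinct. *)
rewrite coef_sum (bigD1 0) //= -[2%N]/(1 + 1)%N; apply: leq_add.
  by rewrite coefXn; case: eqP.
rewrite (eq_bigr (fun a : 'Z_k => nat_of_bool (l == diff_wt a)))
  => [|a _]; last first.
  by rewrite coefXn natn.
rewrite (_ : (\sum_(_ | _) _)%R =
    #|[pred a : 'Z_k | (a != 0) && (l == diff_wt a)]|); last first.
  by rewrite -sum1_card [RHS]big_mkcondr; apply: eq_bigr => a _; case: ifP.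
apply/card_le1_eqP => a b; rewrite !inE /diff_wt => /andP[/negbTE -> /eqP la].
case/andP=> /negbTE -> /eqP lb; apply: val_inj => /=.
have ltk (c : 'Z_k) : (c < k)%N.
  by apply: leq_trans (ltn_ord c) _; rewrite Zp_cast; lia.
by have := ltk a; have := ltk b; lia.
Qed.

(** When [x > eps], [x * eps^3 <= x^4]. This turns a bound on a fourth power into one on [x] without
    taking roots. *)
Lemma le_eps_pow4 (R : realType) (x eps : R) : 0 < eps -> 0 <= x ->
  x <= eps + x ^+ 4 / eps ^+ 3.
Proof.
move=> e0 x0; have [xe|ex] := leP x eps.
  by apply: le_trans xe _; rewrite lerDl divr_ge0 // exprn_ge0 // ltW.
rewrite -[leLHS]add0r lerD ?(ltW e0) // ler_pdivlMr ?exprn_gt0 // [x ^+ 4]exprS.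
by rewrite ler_wpM2l // ler_pXn2r ?nnegrE ?(ltW e0) ?(ltW ex).
Qed.

Lemma two_term_pow_coef_eps (R : realType) (eps : R) (u v j i : nat) :
  0 < eps -> (v < u)%N ->
  ((('X^u + 'X^v : {poly nat}) ^+ j)`_i)%R%:R <=
    2 ^+ j * (eps + eps ^- 3 / j.+1%:R) :> R.
Proof.
move=> e0 vu; have := two_term_pow_coef j i vu; set c := _`_i => cle.
have p0 : 0 < 2 ^+ j :> R by rewrite exprn_gt0.
rewrite -ler_pdivrMl // mulrC; apply: le_trans (le_eps_pow4 e0 _) _.
  by rewrite divr_ge0 // ltW.
rewrite lerD2l [leLHS]mulrC ler_wpM2l ?invr_ge0 ?exprn_ge0 ?(ltW e0) //.
rewrite expr_div_n ler_pdivrMr ?exprn_gt0 // ler_pdivlMl //.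
have : (c ^ 4 * j.+1 <= (2 ^ j) ^ 4)%N.
  rewrite -expnM mulnC [(j * 4)%N]mulnC expnM; apply: leq_trans cle.
  by rewrite mulnC leq_mul2l; apply/orP; right; lia.
by rewrite -(ler_nat R) natrM !natrX mulrC.
Qed.

(** In the expansion of [(B + Q)^n], where [B] collects the weights of 1 and 0, [coefM_le] reduces
    each term to a coefficient of a power of [B]. The exponents in [B] differ because [k > 2]. *)
Lemma wt_poly_pow_coef (R : realType) (eps : R) (k n i : nat) :
  0 < eps -> (2 < k)%N ->
  ((wt_poly k ^+ n)`_i)%R%:R <= k%:R ^+ n * (eps + eps ^- 3 * k%:R / n.+1%:R) :> R.
Proof.
move=> e0 k2.
pose B : {poly nat} := 'X^(2 * k - 2) + 'X^k.
pose Q : {poly nat} := \sum_(a : 'Z_k | (a != 0) && (a != 1)) 'X^(diff_wt a).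
have one0 : (1 : 'Z_k) != 0 by rewrite oner_eq0.
have PE : wt_poly k = B + Q.
  rewrite /wt_poly (bigD1 0) //= (bigD1 1) //= /Q addrA; congr (_ + _).
  by rewrite /B addrC diff_wt1 // {1}/diff_wt eqxx.
have Q1 : Q.[1] = (k - 2)%N.
  have := wt_poly1 (ltnW k2); rewrite PE hornerD /B hornerD !hornerXn !expr1n => <-.
  by rewrite -[X in (X - _)%N]/(2 + Q.[1])%N addKn.
rewrite PE exprDn coef_sum natr_sum.
pose q : R := (k - 2)%:R.
have term (j : 'I_n.+1) : ((B ^+ (n - j) * Q ^+ j *+ 'C(n, j))`_i)%R%:R <=
    eps * (2 ^+ (n - j) * q ^+ j *+ 'C(n, j))
    + eps ^- 3 / n.+1%:R * (2 ^+ (n.+1 - j) * q ^+ j *+ 'C(n.+1, j)).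
  have jn : (j <= n)%N by rewrite -ltnS.
  have [l le] := coefM_le (B ^+ (n - j)) (Q ^+ j) i.
  rewrite horner_exp Q1 in le.
  have {}le : ((B ^+ (n - j) * Q ^+ j)`_i)%R%:R <=
      2 ^+ (n - j) * (eps + eps ^- 3 / (n - j).+1%:R) * q ^+ j :> R.
    apply: le_trans (_ : ((B ^+ (n - j))`_l)%R%:R * q ^+ j <= _).
      by move: le; rewrite -(ler_nat R) natrM natrX.
    by rewrite ler_wpM2r ?exprn_ge0 // two_term_pow_coef_eps //; lia.
  have natMn (x c : nat) : (x *+ c)%:R = x%:R *+ c :> R.
    by rewrite -[RHS]mulr_natr -natrM -[(x *+ c)%R]mulr_natr natn.
  rewrite coefMn natMn.
  apply: le_trans (ler_wMn2r _ le) _.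
  (* The denominator [n-j+1] is absorbed by passing to row [n+1], so the error terms again form a
     binomial sum. *)
  have bE : ('C(n, j))%:R / (n - j).+1%:R = ('C(n.+1, j))%:R / n.+1%:R :> R.
    apply/eqP; rewrite eqr_div ?pnatr_eq0 // -!natrM eqr_nat mulnC.
    by rewrite (mul_bin_down n.+1 j) subSn // mulnC.
  rewrite -!(mulr_natr (_ * _)).
  rewrite (_ : _ * _ * q ^+ j * _ = eps * (2 ^+ (n - j) * q ^+ j * ('C(n, j))%:R) +
    eps ^- 3 * (2 ^+ (n - j) * q ^+ j) * (('C(n, j))%:R / (n - j).+1%:R));
    last by ring.
  rewrite bE lerD2l -!mulrA ler_wpM2l ?invr_ge0 ?exprn_ge0 ?(ltW e0) //.
  rewrite [leLHS](_ : _ =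
    2 ^+ (n - j) * (n.+1%:R^-1 * (q ^+ j * ('C(n.+1, j))%:R))); last by ring.
  rewrite [leRHS](_ : _ =
    2 ^+ (n.+1 - j) * (n.+1%:R^-1 * (q ^+ j * ('C(n.+1, j))%:R))); last by ring.
  rewrite ler_wpM2r // ?mulr_ge0 ?invr_ge0 ?exprn_ge0 //.
  by rewrite subSn // exprS ler_peMl ?exprn_ge0 // ler1n.
have kE : k%:R = 2 + q :> R by rewrite /q -natrD subnKC // ltnW.
apply: le_trans (ler_sum _ (fun j _ => term j)) _.
rewrite big_split /= -!mulr_sumr -exprDn -kE mulrDr lerD //; first by rewrite mulrC.
rewrite [leRHS](_ : _ = eps ^- 3 / n.+1%:R * k%:R ^+ n.+1); last first.
  by rewrite [k%:R ^+ n.+1]exprS; ring.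
rewrite ler_wpM2l ?divr_ge0 ?invr_ge0 ?exprn_ge0 ?(ltW e0) //.
(* The error sum lacks only the nonnegative term [j = n+1] of [(2 + q)^(n+1)]. *)
by rewrite kE exprDn [leRHS]big_ord_recr /= lerDl mulrn_wge0 // mulr_ge0 ?exprn_ge0.
Qed.

(** * Asymptotics *)

(** The [p] windows of a period and their reverses are [2p] distinct words. *)
Lemma orientable_period_le (k N : nat) (S : nat -> 'Z_k) (p : nat) :
  (1 < k)%N -> orientable_sequence N S p -> (2 * p <= k ^ N)%N.
Proof.
move=> k1 [[[p0 _ _] win] ori].
pose w (i : 'I_p) : N.-tuple 'Z_k := [tuple of mkseq (fun j => S (i + j)%N) N].
pose f (x : bool * 'I_p) : N.-tuple 'Z_k :=
  if x.1 then [tuple of rev (w x.2)] else w x.2.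
have winj i j : tval (w i) = tval (w j) -> i = j.
  by move/win; rewrite !modn_small // => ij; apply: val_inj.
have finj : injective f.
  move=> [[] i] [[] j] /(congr1 val) /= ij.
  - by congr (_, _); apply: winj; apply: (can_inj revK).
  - by case: (ori j i).
  - by case: (ori i j).
  - by congr (_, _); apply: winj.
have := leq_card f finj.
by rewrite card_prod card_bool card_ord card_tuple card_Zk.
Qed.

Lemma lambda_bounds (R : realType) (k n : nat) : (2 < k)%N -> (0 < n)%N ->
  1 - (ties k n)%:R / k%:R ^+ n <= 2 * (lambda n.+1 k)%:R / k%:R ^+ n.+1 :> R /\
  2 * (lambda n.+1 k)%:R / k%:R ^+ n.+1 <= 1 :> R.
Proof.
move=> k2 n0; have [[S Smax] max] := lambdaP (n0 : 1 < n.+1)%N k2.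
have K0 : 0 < k%:R :> R by rewrite ltr0n; lia.
split; last first.
  rewrite ler_pdivrMr ?exprn_gt0 // mul1r -natrX -natrM ler_nat.
  exact: orientable_period_le (ltnW k2) Smax.
have [S' /max le] := heavy_orientable n0 k2.
rewrite ler_pdivlMr ?exprn_gt0 // mulrBl mul1r {2}exprS mulrCA.
rewrite divfK ?expf_neq0 ?gt_eqF // lerBlDr -natrX -!natrM -natrD ler_nat.
rewrite -(card_heavy n (ltnW k2)).
by rewrite leq_add2r leq_mul2l.
Qed.

(** Every correction term in either parity is at most a small multiple of [n * k^(n/2)]. The bound
    is explicit in both [n] and [k], so it serves both limits. *)
Lemma sk_dist (R : realType) (k n : nat) : (2 < k)%N -> (0 < n)%N ->
  `|2 * sk R k (n - 1) / k%:R ^+ n - 1| <= 8 * n%:R / k%:R ^+ (n - n %/ 2) :> R.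
Proof.
move=> k2 n0; pose h := (n %/ 2)%N.
have K3 : 3 <= k%:R :> R by rewrite ler_nat.
have K0 : 0 < k%:R :> R by apply: lt_le_trans K3.
have Kn0 : 0 < k%:R ^+ n :> R by rewrite exprn_gt0.
have K1 : 1 <= k%:R :> R by apply: le_trans K3; lra.
have Kh : 1 <= k%:R ^+ h :> R by rewrite exprn_ege1.
have n1 : 1 <= n%:R :> R by rewrite ler1n.
suff le : `|2 * sk R k (n - 1) - k%:R ^+ n| <= 8 * (n%:R * k%:R ^+ h).
  rewrite (_ : _ - 1 = (2 * sk R k (n - 1) - k%:R ^+ n) / k%:R ^+ n); last first.
    by rewrite mulrBl divff // gt_eqF.
  rewrite normrM normfV (gtr0_norm Kn0) ler_pdivrMr //; apply: le_trans le _.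
  rewrite -!mulrA ler_pM2l // ler_pM2l ?ltr0n // ler_pdivlMl ?exprn_gt0 //.
  by rewrite -exprD subnK // leq_div.
set t : R := n%:R * k%:R ^+ h.
have nt : n%:R <= t by rewrite ler_peMr.
rewrite /sk subn1 prednK //; case: ifP => on.
  have -> : ((n - 1) %/ 2 = h)%N by rewrite /h; lia.
  rewrite ler_norml mulrBr mulr1 -/t /delta; case: odd; lra.
have hS : (h = ((n - 2) %/ 2).+1)%N by rewrite /h; lia.
have mn : (odd_part n <= n)%N by rewrite /odd_part leq_div.
set m := odd_part n in mn *.
have mh : ((m - 1) %/ 2 <= h)%N by rewrite /h leq_div2r //; lia.
set z : R := k%:R ^+ ((n - 2) %/ 2); set y : R := k%:R ^+ ((m - 1) %/ 2).
have tz : t = n%:R * z * k%:R by rewrite /t hS exprSr mulrA.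
have z0 : 0 <= n%:R * z by rewrite mulr_ge0 // exprn_ge0 // ltW.
have y1 : 1 <= y by rewrite exprn_ege1.
have yh : y <= k%:R ^+ h by rewrite /y ler_weXn2l.
have nz : n%:R * z * 3 <= t by rewrite tz ler_wpM2l.
have nyt : n%:R * y <= t by rewrite ler_wpM2l.
have mR : m%:R <= n%:R :> R by rewrite ler_nat.
have m0 : 0 <= m%:R :> R by [].
have my : m%:R * 1 <= m%:R * y by rewrite ler_wpM2l.
have myt : m%:R * y <= t by apply: le_trans nyt; rewrite ler_wpM2r //; lra.
have ny0 : 0 <= n%:R * y by rewrite mulr_ge0 //; lra.
rewrite ler_norml /delta; move: tz; case: odd => tz; lra.
Qed.

Lemma sqr_le_expn3 (l : nat) : (l ^ 2 <= 3 ^ l)%N.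
Proof.
case: l => [|[|l]] //; elim: l => [//|l IH].
by rewrite expnS; apply: leq_trans (leq_mul (leqnn 3) IH); lia.
Qed.

Lemma cvg_harmonic_dist (R : realType) (u : nat -> R) (l c : R) (N0 : nat) :
  (forall n, (N0 <= n)%N -> `|u n - l| <= c / n.+1%:R) -> u @ \oo --> l.
Proof.
move=> le; have cvg0 : (fun n => c * @harmonic R n) @ \oo --> (0 : R).
  by rewrite -[X in _ --> X](mulr0 c); apply: cvgMr; exact: cvg_harmonic.
apply/cvgrPdist_le => e e0.
move/cvgrPdist_le: cvg0 => /(_ e e0) cvg0.
near=> n; rewrite distrC; apply: (@le_trans _ _ (c / n.+1%:R)).
  by apply: le; near: n; exists N0.
have : `|0 - c * harmonic n| <= e by near: n.
by rewrite sub0r normrN; apply: le_trans; rewrite ler_norm.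
Unshelve. all: by end_near. Qed.

Lemma sk_cvg_n (R : realType) (k : nat) : (2 < k)%N ->
  (fun n => 2 * sk R k (n - 1) / k%:R ^+ n) @ \oo --> (1 : R).
Proof.
(* With [l = n - n %/ 2] and [n <= 2l], [n (n+1) <= 6 l^2 <= 6 * 3^l], whence [48 = 8 * 6]. *)
move=> k2; apply: (@cvg_harmonic_dist _ _ _ 48 1%N) => n n0.
apply: le_trans (sk_dist R k2 n0) _; set l := (n - n %/ 2)%N.
have K0 : 0 < k%:R :> R by rewrite ltr0n; lia.
rewrite ler_pdivrMr ?exprn_gt0 // mulrAC ler_pdivlMr //.
rewrite -natrX -!natrM ler_nat.
have kl : (3 ^ l <= k ^ l)%N by rewrite leq_exp2r //; lia.
have := sqr_le_expn3 l; have : (n <= 2 * l)%N by lia.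
by move: (3 ^ l)%N (k ^ l)%N kl => x y; nia.
Qed.

Lemma sk_cvg_k (R : realType) (n : nat) : (2 < n)%N ->
  (fun k => 2 * sk R k (n - 1) / k%:R ^+ n) @ \oo --> (1 : R).
Proof.
(* The power of [k] in [sk_dist] is at least [k], and [k + 1 <= 2k] doubles the constant 8. *)
move=> n2; apply: (@cvg_harmonic_dist _ _ _ (16 * n%:R) 3%N) => k k2.
apply: le_trans (sk_dist R k2 (ltnW (ltnW n2))) _.
have K0 : 0 < k%:R :> R by rewrite ltr0n; lia.
rewrite ler_pdivrMr ?exprn_gt0 // mulrAC ler_pdivlMr //.
rewrite -natrX -!natrM ler_nat.
have : (k ^ 1 <= k ^ (n - n %/ 2))%N by rewrite leq_pexp2l //; lia.
by rewrite expn1; move: (k ^ _)%N => x; nia.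
Qed.

Lemma lambda_cvg_n (R : realType) (k : nat) : (2 < k)%N ->
  (fun n => 2 * (lambda n.+1 k)%:R / k%:R ^+ n.+1) @ \oo --> (1 : R).
Proof.
move=> k2; have K0 : 0 < k%:R :> R by rewrite ltr0n; lia.
(* Half of [e] is the [eps] of [wt_poly_pow_coef]; the other half bounds the term vanishing with
   [n]. *)
apply/cvgrPdist_le => e e0; pose d := e / 2.
have d0 : 0 < d by rewrite divr_gt0.
have : (fun n => d ^- 3 * k%:R * @harmonic R n) @ \oo --> (0 : R).
  rewrite -[X in _ --> X](mulr0 (d ^- 3 * k%:R)).
  by apply: cvgMr; exact: cvg_harmonic.
move/cvgrPdist_le => /(_ d d0) cvg0; near=> n.
have n0 : (0 < n)%N by near: n; exists 1%N.
have [lo up] := lambda_bounds R k2 n0.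
rewrite ger0_norm ?subr_ge0 // lerBlDr -lerBlDl; apply: le_trans lo.
rewrite lerD2l lerN2 ties_coef ler_pdivrMr ?exprn_gt0 // mulrC.
apply: le_trans (wt_poly_pow_coef n _ d0 k2) _.
rewrite ler_wpM2l ?exprn_ge0 ?(ltW K0) // [leRHS]splitr -/d lerD2l.
have : `|0 - d ^- 3 * k%:R * harmonic n| <= d by near: n.
by rewrite sub0r normrN; apply: le_trans; rewrite ler_norm.
Unshelve. all: by end_near. Qed.

Lemma lambda_cvg_k (R : realType) (n : nat) : (0 < n)%N ->
  (fun k => 2 * (lambda n.+1 k)%:R / k%:R ^+ n.+1) @ \oo --> (1 : R).
Proof.
(* [ties_le2] bounds the deficit by [2/k], and [2/k <= 4/(k+1)]. *)
case: n => [//|n] _; apply: (@cvg_harmonic_dist _ _ _ 4 3%N) => k k2.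
have K0 : 0 < k%:R :> R by rewrite ltr0n; lia.
have [lo up] := lambda_bounds R k2 (ltn0Sn n).
rewrite distrC ger0_norm ?subr_ge0 // lerBlDr -lerBlDl; apply: le_trans lo.
rewrite lerD2l lerN2 ler_pdivrMr ?exprn_gt0 // mulrAC ler_pdivlMr //.
rewrite -natrX -!natrM ler_nat expnS.
by have := ties_le2 n k2; move: (k ^ n)%N => x; nia.
Qed.

(** The inverse of [lambda] stays an opaque factor, so the value 0 is covered; for [k = 0] both
    sides vanish by the convention that 0 has inverse 0. *)
Lemma sk_lambda_ratioE (R : realType) (k n : nat) : (0 < n)%N ->
  k%:R * sk R k (n - 1) / (lambda n.+1 k)%:R =
  2 * sk R k (n - 1) / k%:R ^+ n * (2 * (lambda n.+1 k)%:R / k%:R ^+ n.+1)^-1 :> R.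
Proof.
move=> n0; have [->|k0] := eqVneq (k%:R : R) 0.
  by rewrite mul0r expr0n gtn_eqF // invr0 mulr0 !mul0r.
rewrite !invfM invrK exprS; move: ((lambda n.+1 k)%:R^-1 : R) => L.
by field; rewrite ?expf_neq0 ?k0.
Qed.

Theorem theorem5p11 (R : realType) :
  (forall k : nat, (3 <= k)%N ->
     (fun n : nat => k%:R * sk R k (n - 1) / (lambda n.+1 k)%:R) @ \oo --> (1 : R)) /\
  (forall n : nat, (3 <= n)%N ->
     (fun k : nat => k%:R * sk R k (n - 1) / (lambda n.+1 k)%:R) @ \oo --> (1 : R)).
Proof.
have quot (a b : nat -> R) : a @ \oo --> (1 : R) -> b @ \oo --> (1 : R) ->
    (fun i => a i * (b i)^-1) @ \oo --> (1 : R).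
  move=> a1 b1; rewrite -[X in _ --> X](mulr1 1) -{2}invr1.
  by apply: cvgM => //; apply: cvgV => //; rewrite oner_neq0.
split=> [k k2|n n2].
  apply: cvg_trans (quot _ _ (sk_cvg_n k2) (lambda_cvg_n k2)).
  apply: near_eq_cvg; near=> n; rewrite -sk_lambda_ratioE //.
  by near: n; exists 1%N.
have n0 : (0 < n)%N by lia.
under eq_fun do rewrite sk_lambda_ratioE //.
exact: quot (sk_cvg_k n2) (lambda_cvg_k n0).
Unshelve. all: by end_near. Qed.
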